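(* If $Q$ is a connected quandle, then for every biquandle structure on $Q$ the induced biquandle is also connected.
   Context: A quandle is a set $Q$ with an operation $*$ such that $x*x=x$; each map $x\mapsto x*y$ is a bijection (with inverse written $x\mapsto x*^{-1}y$); and $(x*y)*z=(x*z)*(y*z)$. A quandle $Q$ is connected if for any $x,y\in Q$ there exist $z_1,\dots,z_n\in Q$ and $\epsilon_1,\dots,\epsilon_n\in\{1,-1\}$ with $y=x*^{\epsilon_1}z_1*^{\epsilon_2}\cdots*^{\epsilon_n}z_n$ (bracketed from the left). A biquandle is a set $X$ with two binary operations $\underline{\ast},\overline{\ast}$ such that: (i) $x\,\underline{\ast}\,x=x\,\overline{\ast}\,x$ for all $x$; (ii) for every $y$ the maps $x\mapsto x\,\underline{\ast}\,y$ and $x\mapsto x\,\overline{\ast}\,y$ are bijections of $X$, and $S(x,y)=(y\,\overline{\ast}\,x,\;x\,\underline{\ast}\,y)$ is a bijection of $X\times X$; (iii) for all $x,y,z$: $(x\underline{\ast}y)\underline{\ast}(z\underline{\ast}y)=(x\underline{\ast}z)\underline{\ast}(y\overline{\ast}z)$, $(x\underline{\ast}y)\overline{\ast}(z\underline{\ast}y)=(x\overline{\ast}z)\underline{\ast}(y\overline{\ast}z)$, $(x\overline{\ast}y)\overline{\ast}(z\overline{\ast}y)=(x\overline{\ast}z)\overline{\ast}(y\underline{\ast}z)$. A biquandle structure on a quandle $(Q,* )$ is a family of quandle automorphisms $\{\beta_y\mid y\in Q\}$ of $Q$ such that (1) $\beta_{\beta_y(x*y)}\circ\beta_y=\beta_{\beta_x(y)}\circ\beta_x$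 for all $x,y\in Q$, and (2) $y\mapsto\beta_y(y)$ is a bijection of $Q$. The induced biquandle is the set $Q$ with $x\,\underline{\ast}\,y=\beta_y(x*y)$ and $x\,\overline{\ast}\,y=\beta_y(x)$ (this is a biquandle, a known fact). For a biquandle $X$, let $\sim_c$ be the equivalence relation generated by $x\sim_c x\,\underline{\ast}\,y$ and $x\sim_c x\,\overline{\ast}\,y$ for all $x,y\in X$. The biquandle is connected if there is only one equivalence class. *)

(* Defs.v *)
From Stdlib Require Import IndefiniteDescription Relation_Operators.
From mathcomp Require Import all_boot.

Set Implicit Arguments.
Unset Strict Implicit.
Unset Printing Implicit Defensive.

Declare Scope quandle_scope.
Open Scope quandle_scope.

(** * Quandles *)

(* Bijectivity of the right translations is given by the inverse operation
   [qinv], which the two cancellation laws determine uniquely. *)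
Record quandle := Quandle {
  qcarrier :> Type;
  qop : qcarrier -> qcarrier -> qcarrier;
  qinv : qcarrier -> qcarrier -> qcarrier;
  qop_idem : forall x, qop x x = x;
  qopK : forall y, cancel (fun x => qop x y) (fun x => qinv x y);
  qinvK : forall y, cancel (fun x => qinv x y) (fun x => qop x y);
  qop_dist : forall x y z, qop (qop x y) z = qop (qop x z) (qop y z)
}.

Notation "x \* y" := (qop x y) (at level 40, left associativity)
  : quandle_scope.
Notation "x \*^-1 y" := (qinv x y) (at level 40, left associativity)
  : quandle_scope.

(* The exponent 1 is encoded by [true], the exponent -1 by [false]. *)
Definition qop_sign (Q : quandle) (x : Q) (ze : Q * bool) : Q :=
  if ze.2 then x \* ze.1 else x \*^-1 ze.1.

(* The empty word may be allowed: it relates x to itself, as does x * x. *)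
Definition quandle_connected (Q : quandle) : Prop :=
  forall x y : Q, exists w : seq (Q * bool), y = foldl (@qop_sign Q) x w.

Definition quandle_automorphism (Q : quandle) (f : Q -> Q) : Prop :=
  bijective f /\ {morph f : x y / x \* y}.

(** * Biquandles *)

Definition biquandle_switch (X : Type) (uop oop : X -> X -> X) (p : X * X)
  : X * X := (oop p.2 p.1, uop p.1 p.2).

Record biquandle := Biquandle {
  bcarrier :> Type;
  uop : bcarrier -> bcarrier -> bcarrier;
  oop : bcarrier -> bcarrier -> bcarrier;
  uop_diag : forall x, uop x x = oop x x;
  uop_bij : forall y, bijective (fun x => uop x y);
  oop_bij : forall y, bijective (fun x => oop x y);
  switch_bij : bijective (biquandle_switch uop oop);
  exchange_uu : forall x y z,
    uop (uop x y) (uop z y) = uop (uop x z) (oop y z);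
  exchange_uo : forall x y z,
    oop (uop x y) (uop z y) = uop (oop x z) (oop y z);
  exchange_oo : forall x y z,
    oop (oop x y) (oop z y) = oop (oop x z) (uop y z)
}.

Notation "x \_* y" := (uop x y) (at level 40, left associativity)
  : quandle_scope.
Notation "x \^* y" := (oop x y) (at level 40, left associativity)
  : quandle_scope.

Definition biquandle_step (X : biquandle) (x z : X) : Prop :=
  exists y : X, z = x \_* y \/ z = x \^* y.

Definition biquandle_equiv (X : biquandle) : X -> X -> Prop :=
  clos_refl_sym_trans X (@biquandle_step X).

(* As for quandles, the empty structure counts as connected. *)
Definition biquandle_connected (X : biquandle) : Prop :=
  forall x y : X, biquandle_equiv x y.

(** * Biquandle structures on a quandle *)

Record biquandle_structure (Q : quandle) := BiquandleStructure {
  beta :> Q -> Q -> Q; (* [beta y x] is the image of x under beta_y *)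
  beta_aut : forall y, quandle_automorphism (beta y);
  beta_comp : forall x y,
    beta (beta y (x \* y)) \o beta y =1 beta (beta x y) \o beta x;
  beta_diag_bij : bijective (fun y => beta y y)
}.

Section InducedBiquandle.
Variables (Q : quandle) (b : biquandle_structure Q).

Definition induced_uop (x y : Q) : Q := b y (x \* y).
Definition induced_oop (x y : Q) : Q := b y x.

Lemma induced_diag x : induced_uop x x = induced_oop x x.
Proof. by rewrite /induced_uop qop_idem. Qed.

Lemma induced_uop_bij y : bijective (fun x => induced_uop x y).
Proof.
have [bij_b _] := beta_aut b y.
apply: (bij_comp bij_b); exists (fun x => x \*^-1 y); [exact: qopK | exact: qinvK].
Qed.

Lemma induced_oop_bij y : bijective (fun x => induced_oop x y).
Proof. by have [] := beta_aut b y. Qed.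

Lemma inj_surj_bij (A B : Type) (f : A -> B) :
  injective f -> (forall y, exists x, f x = y) -> bijective f.
Proof.
move=> f_inj f_surj.
pose g y := proj1_sig (constructive_indefinite_description _ (f_surj y)).
have gK : cancel g f.
  by move=> y; exact: proj2_sig (constructive_indefinite_description _ (f_surj y)).
by exists g => // x; apply: f_inj; rewrite gK.
Qed.

Lemma induced_switch_bij : bijective (biquandle_switch induced_uop induced_oop).
Proof.
have diag x y : b (induced_uop x y) (b y y) = b (b x y) (b x y).
  exact: (beta_comp b x y y).
have inj_diag := bij_inj (beta_diag_bij b).
apply: inj_surj_bij => [[x1 y1] [x2 y2]|[a c]]; rewrite /biquandle_switch /=.
  rewrite /induced_oop => -[eq_a eq_c].
  have eq_y : y1 = y2.
    apply: inj_diag; have [bij_b _] := beta_aut b (induced_uop x1 y1).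
    by apply: (bij_inj bij_b); rewrite diag eq_c diag eq_a.
  rewrite -{y2}eq_y in eq_a eq_c *; congr pair.
  exact: (bij_inj (induced_uop_bij y1)) eq_c.
have [[bi _ biK] _] := beta_aut b c.
have [d _ dK] := beta_diag_bij b.
pose y := d (bi (b a a)).
have yE : b c (b y y) = b a a by rewrite dK biK.
have [u _ uK] := induced_uop_bij y.
exists (u c, y); rewrite /= uK; congr pair.
by apply: inj_diag; rewrite -diag uK yE.
Qed.

Lemma induced_exchange_uu x y z :
  induced_uop (induced_uop x y) (induced_uop z y)
  = induced_uop (induced_uop x z) (induced_oop y z).
Proof.
have [_ by_morph] := beta_aut b y; have [_ bz_morph] := beta_aut b z.
rewrite /induced_uop /induced_oop -by_morph -bz_morph -!qop_dist.
exact: (beta_comp b z y).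
Qed.

Lemma induced_exchange_uo x y z :
  induced_oop (induced_uop x y) (induced_uop z y)
  = induced_uop (induced_oop x z) (induced_oop y z).
Proof.
have [_ bz_morph] := beta_aut b z.
rewrite /induced_uop /induced_oop -bz_morph.
exact: (beta_comp b z y).
Qed.

Lemma induced_exchange_oo x y z :
  induced_oop (induced_oop x y) (induced_oop z y)
  = induced_oop (induced_oop x z) (induced_uop y z).
Proof. by symmetry; exact: (beta_comp b y z). Qed.

Definition induced_biquandle : biquandle :=
  @Biquandle Q induced_uop induced_oop induced_diag
    induced_uop_bij induced_oop_bij induced_switch_bij
    induced_exchange_uu induced_exchange_uo induced_exchange_oo.

End InducedBiquandle.

(* Main.v *)
Require Import Defs.
From mathcomp Require Import all_boot.
From Stdlib Require Import Relation_Operators.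

(** The same automorphism [b y] ends both biquandle operations, so [x] and [x \* y] share a
    neighbour and lie in one class. Each letter of a word joining two points of [Q] thus preserves
    the class, and induction on the word leaves a single class. *)

(* Both [x] and [x \* y] step to [b y (x \* y)]: the former by the lower
   operation, the latter by the upper one. *)
Lemma induced_equiv_qop (Q : quandle) (b : biquandle_structure Q) (x y : Q) :
  @biquandle_equiv (induced_biquandle b) x (x \* y).
Proof.
apply: (@rst_trans _ _ _ (b y (x \* y))).
  by apply: rst_step; exists y; left.
by apply: rst_sym; apply: rst_step; exists y; right.
Qed.

Theorem proposition3p8 (Q : quandle) (hQ : quandle_connected Q)
    (b : biquandle_structure Q) :
  biquandle_connected (induced_biquandle b).
Proof.
move=> x y; have [w ->] := hQ x y.
elim: w x => [|[z e] w IHw] x /=; first exact: rst_refl.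
apply: rst_trans (IHw _); case: e; rewrite /qop_sign /=.
  exact: induced_equiv_qop.
(* An inverse letter is a positive one read backwards: [x = u \* z] for [u = x \*^-1 z]. *)
by apply: rst_sym; rewrite -{2}(qinvK z x); exact: induced_equiv_qop.
Qed.
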